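(* Fix a face $\mathcal F^{(k)}$ of the capacity region $\mathcal R$ and $\boldsymbol\lambda^{(k)}\in\mathrm{Relint}(\mathcal F^{(k)})$ in the scheduling problem (setting in the context), and consider the MW scheduler under the arrival process $\{\mathbf A^{(\epsilon)}[t]\}_t$ with mean vector $\boldsymbol\lambda^{(\epsilon)}=\boldsymbol\lambda^{(k)}-\epsilon\,\mathbf c^{(k)}\in\mathrm{Int}(\mathcal R)$. Let $\overline{\mathbf Q}^{(\epsilon)}$ be the limiting steady-state queue-length vector and $$\overline{\mathbf Q}_\perp^{(\epsilon,k)}=\overline{\mathbf Q}^{(\epsilon)}-\langle\mathbf c^{(k)},\overline{\mathbf Q}^{(\epsilon)}\rangle\,\mathbf c^{(k)} .$$ Then there exist finite constants $\{N_r^{(k)}\}_{r=1,2,\dots}$, independent of $\epsilon$, such that $\mathbb E\big[\|\overline{\mathbf Q}_\perp^{(\epsilon,k)}\|^r\big]\le N_r^{(k)}$ for all $\epsilon>0$ (with $\boldsymbol\lambda^{(\epsilon)}\in\mathrm{Int}(\mathcal R)$) and each $r=1,2,\dots$.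
   Context: Scheduling model. There are $L$ queues in slotted time $t=0,1,2,\dots$ with nonnegative-integer lengths $\mathbf Q[t]=(Q_l[t])_{l=1}^L$ evolving as $Q_l[t+1]=(Q_l[t]+A_l[t]-S_l[t])^+$. The arrival processes $\{A_l[t]\}_t$ of different queues are independent; each is i.i.d. over time, nonnegative-integer valued and bounded by $A_{\max}<\infty$. In each slot a scheduler selects a service vector $\mathbf S[t]$ from a fixed finite set $\mathcal S$ of nonnegative-integer vectors in $\mathbb R^L$ with entries at most $S_{\max}<\infty$, containing $\mathbf 0$. The constants $A_{\max},S_{\max}$ and the set $\mathcal S$ do not depend on $\epsilon$. MW policy: $\mathbf S[t]$ is chosen uniformly at random from $\arg\max_{\mathbf S\in\mathcal S}\langle\mathbf Q[t],\mathbf S\rangle$. Capacity region: $\mathcal R=\mathrm{ConvexHull}(\mathcal S)$, assumed to be described as $\mathcal R=\{\mathbf r\ge\mathbf 0:\langle\mathbf c^{(k)},\mathbf r\rangle\le b^{(k)},\ k=1,\dots,K\}$ with $K$ finite and minimal and $\|\mathbf c^{(k)}\|=1$, $\mathbf c^{(k)}\ge\mathbf 0$ componentwise, $b^{(k)}>0$. Put $\mathcal H^{(k)}=\{\mathbf r:\langle\mathbf c^{(k)},\mathbf r\rangle=b^{(k)}\}$ and $\mathcal F^{(k)}=\mathcal H^{(k)}\cap\mathcal R$ (the $k$-th face). $\mathrm{Relint}$ is relative interior, $\mathrm{Int}$ is interior, $\langle\cdot,\cdot\rangle$ and $\|\cdot\|$ are the Euclidean inner product and norm. Steady state: under MW with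 $\boldsymbol\lambda^{(\epsilon)}\in\mathrm{Int}(\mathcal R)$, the Markov chain $\{\mathbf Q^{(\epsilon)}[t]\}_t$ converges in distribution to a random vector $\overline{\mathbf Q}^{(\epsilon)}$ (its steady state), all of whose moments are finite; this fact is taken as part of the setting. *)

(* Defs.v *)
From HB Require Import structures.
From mathcomp Require Import all_boot all_order all_algebra finmap.
From mathcomp Require Import all_classical all_reals all_analysis.

Set Implicit Arguments.
Unset Strict Implicit.
Unset Printing Implicit Defensive.

Import Order.TTheory GRing.Theory Num.Theory.
Import numFieldNormedType.Exports.

Local Open Scope classical_set_scope.
Local Open Scope ring_scope.

Section Geometry.
Context {R : realType} {L : nat}.
Implicit Types (x y : 'rV[R]_L) (C : set 'rV[R]_L).

Definition dotr x y : R := \sum_(l < L) x 0 l * y 0 l.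

(* The library norm `|x| on row vectors is the sup norm, hence this one. *)
Definition enorm x : R := Num.sqrt (dotr x x).

Definition perp (c x : 'rV[R]_L) : 'rV[R]_L := x - dotr c x *: c.

Definition affine_hull C : set 'rV[R]_L :=
  [set x | exists n (w : 'I_n -> R) (v : 'I_n -> 'rV[R]_L),
    [/\ forall i, C (v i), \sum_i w i = 1 & x = \sum_i w i *: v i]].

Definition convex_hull C : set 'rV[R]_L :=
  [set x | exists n (w : 'I_n -> R) (v : 'I_n -> 'rV[R]_L),
    [/\ forall i, C (v i), forall i, 0 <= w i, \sum_i w i = 1
      & x = \sum_i w i *: v i]].

Definition relint C : set 'rV[R]_L :=
  [set x | C x /\ exists2 e : R, 0 < e &
    forall y, affine_hull C y -> enorm (y - x) < e -> C y].

Definition halfspace_description C K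
    (c : 'I_K -> 'rV[R]_L) (b : 'I_K -> R) : Prop :=
  [/\ forall k, enorm (c k) = 1,
      forall k l, 0 <= c k 0 l,
      forall k, 0 < b k
    & C = [set r : 'rV[R]_L | (forall l, 0 <= r 0 l) /\ (forall k, dotr (c k) r <= b k)]].

Definition minimal_description C K
    (c : 'I_K -> 'rV[R]_L) (b : 'I_K -> R) : Prop :=
  halfspace_description C c b /\
  forall K' (c' : 'I_K' -> 'rV[R]_L) (b' : 'I_K' -> R),
    halfspace_description C c' b' -> (K <= K')%N.

Definition face C (c : 'rV[R]_L) (b : R) : set 'rV[R]_L :=
  [set r : 'rV[R]_L | dotr c r = b] `&` C.

Definition nat_rv (q : {ffun 'I_L -> nat}) : 'rV[R]_L := \row_l (q l)%:R.

Definition capacity_region (calS : {fset {ffun 'I_L -> nat}}) :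
    set 'rV[R]_L :=
  convex_hull [set nat_rv s | s in [set` calS]].

End Geometry.

Arguments capacity_region R {L} calS.

Section MaxWeight.
Context {L : nat}.
Implicit Types (calS : {fset {ffun 'I_L -> nat}}) (q s : {ffun 'I_L -> nat}).

Definition dotn q s : nat := (\sum_(l < L) q l * s l)%N.

Definition mw_argmax calS q : {fset {ffun 'I_L -> nat}} :=
  [fset s in calS | all (fun s' => dotn q s' <= dotn q s)%N (enum_fset calS)]%fset.

Definition mw_weight (R : realType) calS q s : R :=
  if s \in mw_argmax calS q then (#|` mw_argmax calS q|)%:R^-1 else 0.

End MaxWeight.

Section Processes.
Context {R : realType} {d : measure_display} {T : measurableType d}.
Variable P : probability T R.

Definition mutually_independent (I : choiceType) (d' : measure_display)
    (U : measurableType d') (X : I -> {RV P >-> U}) : Prop :=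
  forall (J : {fset I}) (B : I -> set U),
    (forall i, i \in J -> measurable (B i)) ->
    P (\bigcap_(i in [set` J]) (X i @^-1` B i)) =
    (\prod_(i <- J) P (X i @^-1` B i))%E.

Context {L : nat}.
Implicit Types A S Q : nat -> 'I_L -> {RV P >-> nat}.

Definition vec (X : 'I_L -> {RV P >-> nat}) (w : T) : {ffun 'I_L -> nat} :=
  [ffun l => X l w].

(* Independence of the whole doubly indexed family expresses both that the
   queues have independent arrival streams and that each stream is independent
   over time. *)
Record arrival_process (Amax : nat) (lam : 'rV[R]_L) A : Prop := {
  arrival_bounded : forall t l w, (A t l w <= Amax)%N;
  arrival_independent :
    mutually_independent (fun tl : nat * 'I_L => A tl.1 tl.2);
  arrival_identical : forall t l (B : set nat),
    P (A t l @^-1` B) = P (A 0%N l @^-1` B);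
  arrival_mean : forall t l,
    ('E_P[fun w => (A t l w)%:R%R] = (lam 0 l)%:E)%E }.

Definition history A S Q (n t : nat) (q : {ffun 'I_L -> nat})
    (a s : nat -> {ffun 'I_L -> nat}) : set T :=
  [set w | [/\ vec (Q 0%N) w = q,
    forall u, (u < n)%N -> vec (A u) w = a u
    & forall u, (u < t)%N -> vec (S u) w = s u]].

(* The initial queue lengths are arbitrary, independent of the arrivals.  The
   tie-breaking is conditioned on the initial state, the earlier services and
   arrivals over an arbitrary horizon n: given these, S[t] is uniform on the
   argmax, so the randomization carries no information about the arrivals.
   The natural-number subtraction in the recursion is truncated at 0. *)
Record mw_system (calS : {fset {ffun 'I_L -> nat}}) A S Q : Prop := {
  queue_initial : forall q n (a : nat -> {ffun 'I_L -> nat}),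
    P [set w | vec (Q 0%N) w = q /\
               forall u, (u < n)%N -> vec (A u) w = a u] =
    (P [set w | vec (Q 0%N) w = q] *
     P [set w | forall u, (u < n)%N -> vec (A u) w = a u])%E;
  queue_step : forall t l w,
    Q t.+1 l w = (Q t l w + A t l w - S t l w)%N;
  mw_policy : forall n t q0 a s q,
    let H := history A S Q n t q0 a s `&` [set w | vec (Q t) w = q] in
    P (H `&` [set w | vec (S t) w = s t]) =
    (P H * (mw_weight R calS q (s t))%:E)%E }.

End Processes.

(* Weak convergence in R^L, tested on bounded continuous functions; the limit
   may live on a different probability space. *)
Definition cvg_in_distribution (R : realType) (L : nat)
    (d d' : measure_display) (T : measurableType d) (T' : measurableType d')
    (P : probability T R) (P' : probability T' R)
    (X : nat -> T -> 'rV[R]_L) (Y : T' -> 'rV[R]_L) : Prop :=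
  forall f : 'rV[R]_L -> R, continuous f -> (exists M : R, forall x, `|f x| <= M) ->
    ('E_P[f \o X t] @[t --> \oo] --> 'E_P'[f \o Y])%E.

Definition rvec (R : realType) (L : nat) (d : measure_display)
    (T : measurableType d) (P : probability T R)
    (Y : 'I_L -> {RV P >-> R}) (w : T) : 'rV[R]_L :=
  \row_l Y l w.

Definition steady_state (R : realType) (L : nat)
    (d d' : measure_display) (T : measurableType d) (T' : measurableType d')
    (P : probability T R) (P' : probability T' R)
    (Q : nat -> 'I_L -> {RV P >-> nat}) (Y : 'I_L -> {RV P' >-> R}) : Prop :=
  cvg_in_distribution P P' (fun t w => nat_rv (vec (Q t) w)) (rvec Y) /\
  forall r : nat, ('E_P'[fun w => (enorm (rvec Y w) ^+ r)%R] < +oo)%E.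

(* Main.v *)
(** Write V(Q) for the Euclidean norm of Q_perp.  Since the face is a facet, a
    ball of radius delta around lambda^(k) inside the hyperplane H^(k) stays in
    the capacity region, so MaxWeight gives
    <Q_perp, lambda^(eps) - S> <= - delta V(Q) for every maximizing S; the shift
    eps c^(k) drops out because it is orthogonal to Q_perp.  Hence
    E[V(Q[t+1])^2 - V(Q[t])^2 | Q[t]] <= D^2 - 2 delta V(Q[t]), where D bounds
    the jumps of V, with all constants independent of eps.  As in Hajek's lemma,
    this yields E[exp(theta V(Q[t+1])) | Q[t]] <= rho exp(theta V(Q[t])) + C with
    rho < 1.  Iterating on the event that the initial queues are at most m,
    where Q[t] takes finitely many values, and testing the weak limit against
    min(V^r, n), one lets t, m and then n go to infinity. *)
Require Import Defs.
From HB Require Import structures.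
From mathcomp Require Import all_boot all_order all_algebra finmap.
From mathcomp Require Import all_classical all_reals all_analysis.
From mathcomp Require Import measurable_realfun ring lra zify.

Set Implicit Arguments.
Unset Strict Implicit.
Unset Printing Implicit Defensive.

Import Order.TTheory GRing.Theory Num.Theory.
Import numFieldNormedType.Exports.

Local Open Scope classical_set_scope.
Local Open Scope ring_scope.

(** * Euclidean inner product, norm and projection orthogonal to [c] *)

Section Euclidean.
Context {R : realType} {L : nat}.
Implicit Types (x y z c : 'rV[R]_L) (C : set 'rV[R]_L).

Lemma dotrC x y : dotr x y = dotr y x.
Proof. by apply: eq_bigr => l _; rewrite mulrC. Qed.

Lemma dotrDl x y z : dotr (x + y) z = dotr x z + dotr y z.
Proof. by rewrite -big_split; apply: eq_bigr => l _; rewrite mxE mulrDl. Qed.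

Lemma dotrZl (a : R) x y : dotr (a *: x) y = a * dotr x y.
Proof. by rewrite /dotr mulr_sumr; apply: eq_bigr => l _; rewrite mxE mulrA. Qed.

Lemma dotrDr x y z : dotr z (x + y) = dotr z x + dotr z y.
Proof. by rewrite dotrC dotrDl !(dotrC z). Qed.

Lemma dotrZr (a : R) x y : dotr x (a *: y) = a * dotr x y.
Proof. by rewrite dotrC dotrZl dotrC. Qed.

Lemma dotrNl x y : dotr (- x) y = - dotr x y.
Proof. by rewrite -scaleN1r dotrZl mulN1r. Qed.

Lemma dotrNr x y : dotr x (- y) = - dotr x y.
Proof. by rewrite dotrC dotrNl dotrC. Qed.

Definition dotrE := (dotrDl, dotrDr, dotrNl, dotrNr, dotrZl, dotrZr).

Lemma dotr_sumr I (r : seq I) (v : I -> 'rV[R]_L) x :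
  dotr x (\sum_(i <- r) v i) = \sum_(i <- r) dotr x (v i).
Proof.
apply: (big_morph (dotr x)) => [y z|]; first exact: dotrDr.
by rewrite -(scale0r x) dotrZr mul0r.
Qed.

Lemma dotr_ge0 x y : (forall l, 0 <= x 0 l) -> (forall l, 0 <= y 0 l) ->
  0 <= dotr x y.
Proof. by move=> x0 y0; apply: sumr_ge0 => l _; apply: mulr_ge0. Qed.

Lemma ler_dotr x y z : (forall l, 0 <= x 0 l) ->
  (forall l, y 0 l <= z 0 l) -> dotr x y <= dotr x z.
Proof. by move=> x0 yz; apply: ler_sum => l _; apply: ler_wpM2l. Qed.

Lemma dotrr_ge0 x : 0 <= dotr x x.
Proof. by apply: sumr_ge0 => l _; rewrite -expr2 sqr_ge0. Qed.

Lemma enorm_ge0 x : 0 <= enorm x.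
Proof. exact: sqrtr_ge0. Qed.

Lemma sqr_enorm x : enorm x ^+ 2 = dotr x x.
Proof. by rewrite sqr_sqrtr // dotrr_ge0. Qed.

Lemma enorm_le x (a : R) : 0 <= a -> dotr x x <= a ^+ 2 -> enorm x <= a.
Proof.
by move=> a0 h; rewrite -(ger0_norm a0) -sqrtr_sqr; apply: ler_wsqrtr.
Qed.

Lemma enormZ (a : R) x : enorm (a *: x) = `|a| * enorm x.
Proof.
by rewrite /enorm !dotrE mulrA -expr2 sqrtrM ?sqr_ge0 // sqrtr_sqr.
Qed.

(** Cauchy-Schwarz, by expanding the square of [a *: x - b *: y] with [a = enorm y] and
    [b = enorm x]; vanishing norms are treated apart. *)
Lemma dotr_le_enorm x y : dotr x y <= enorm x * enorm y.
Proof.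
have h (a b : R) : 2 * (a * b) * dotr x y <=
    a ^+ 2 * enorm x ^+ 2 + b ^+ 2 * enorm y ^+ 2.
  have := dotrr_ge0 (a *: x - b *: y).
  by rewrite !dotrE (dotrC y x) !sqr_enorm; lra.
have [x0 y0] := (enorm_ge0 x, enorm_ge0 y).
have := h (enorm y) (enorm x).
have [xp|] := ltP 0 (enorm x); last first.
  move=> x_le0; have {x_le0}x00 : enorm x = 0 by apply/eqP; rewrite eq_le x_le0.
  have [//|d0] := leP (dotr x y) (enorm x * enorm y).
  rewrite x00 mul0r in d0.
  (* As [enorm x = 0], the factor [a] is free; this choice gives
     [2 * (enorm y ^+ 2 + 1) <= enorm y ^+ 2], which is absurd. *)
  have := h ((enorm y ^+ 2 + 1) / dotr x y) 1; rewrite x00.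
  rewrite mulr1 -mulrA divfK ?gt_eqF //; nra.
have [yp|] := ltP 0 (enorm y); last first.
  move=> y_le0; have {y_le0}y00 : enorm y = 0 by apply/eqP; rewrite eq_le y_le0.
  have [//|d0] := leP (dotr x y) (enorm x * enorm y).
  rewrite y00 mulr0 in d0.
  have := h 1 ((enorm x ^+ 2 + 1) / dotr x y); rewrite y00.
  rewrite mul1r -mulrA divfK ?gt_eqF //; nra.
move=> hh; rewrite -(ler_pM2l (_ : 0 < 2 * (enorm y * enorm x))) ?mulr_gt0 //.
by apply: (le_trans hh); rewrite le_eqVlt; apply/orP; left; apply/eqP; ring.
Qed.

Lemma enormD x y : enorm (x + y) <= enorm x + enorm y.
Proof.
apply: enorm_le; first by rewrite addr_ge0 ?enorm_ge0.
have := dotr_le_enorm x y.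
by rewrite !dotrE (dotrC y x) sqrrD !sqr_enorm; lra.
Qed.

Lemma perpB c x y : perp c (x - y) = perp c x - perp c y.
Proof. by apply/rowP => l; rewrite !mxE !dotrE; ring. Qed.

Section Unit.
Variable c : 'rV[R]_L.
Hypothesis c1 : enorm c = 1.

Let cc1 : dotr c c = 1. Proof. by rewrite -sqr_enorm c1 expr1n. Qed.

Lemma dotr_perp x : dotr c (perp c x) = 0.
Proof. by rewrite /perp !dotrE cc1; ring. Qed.

Lemma sqr_enorm_perp x : enorm (perp c x) ^+ 2 = dotr x x - dotr c x ^+ 2.
Proof. by rewrite sqr_enorm /perp !dotrE cc1 (dotrC x c); ring. Qed.

Lemma enorm_perp_le x : enorm (perp c x) <= enorm x.
Proof.
apply: enorm_le; first exact: enorm_ge0.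
rewrite -sqr_enorm sqr_enorm_perp sqr_enorm.
by have := sqr_ge0 (dotr c x); lra.
Qed.

Lemma enorm_perp_lipschitz x y :
  enorm (perp c x) - enorm (perp c y) <= enorm (x - y).
Proof.
rewrite lerBlDr -{1}(subrK (perp c y) (perp c x)) -perpB.
by apply: le_trans (enormD _ _) _; rewrite lerD2r enorm_perp_le.
Qed.

End Unit.

Lemma interior_direction C x v : interior C x ->
  exists2 t : R, 0 < t & forall s : R, `|s| <= t -> C (x + s *: v).
Proof.
move=> Cx.
have h : (fun s : R => x + s *: v) @ (0 : R) --> x.
  rewrite -[X in _ --> X]addr0 -(scale0r v).
  by apply: cvgD; [exact: cvg_cst|apply: cvgZr_tmp; exact: cvg_id].
have /h /nbhs_ballP[e /= e0 he] := Cx.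
exists (e / 2) => [|s se]; first by rewrite divr_gt0.
apply: he; rewrite /ball /= sub0r normrN.
by apply: le_lt_trans se _; rewrite ltr_pdivrMr // ltr_pMr // ltr1n.
Qed.

End Euclidean.

(** * Faces of a minimal description are facets *)

Section Facet.
Context {R : realType} {L : nat}.
Implicit Types (x y z : 'rV[R]_L) (C : set 'rV[R]_L).

(** Without such a [z], the constraints other than the [k]-th, enumerated by [lift k], would already
    describe [C], against the minimality of [K]. *)
Lemma minimal_description_irredundant C K (c : 'I_K -> 'rV[R]_L) (b : 'I_K -> R)
    (k : 'I_K) : minimal_description C c b ->
  exists z, [/\ forall l, 0 <= z 0 l,
    forall j, j != k -> dotr (c j) z <= b j & b k < dotr (c k) z].
Proof.
case: K c b k => [c b []//|K c b k] [[c1 c0 b0 CE] Cmin]; apply: contrapT => nz.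
suff /Cmin : halfspace_description C (c \o lift k) (b \o lift k).
  by rewrite ltnn.
split=> [j|j l|j|/=]; [exact: c1|exact: c0|exact: b0|].
rewrite CE; apply/seteqP; split => z /= [z0 zb]; split => // j.
have [->|jk] := eqVneq j k.
  rewrite leNgt; apply/negP => zk; apply: nz; exists z; split => // i; rewrite eq_sym => ik.
  by have [i' -> _] := unlift_some ik; exact: (zb i').
by rewrite eq_sym in jk; have [i' -> _] := unlift_some jk; exact: (zb i').
Qed.

(** Since [t] ranges over all reals, the whole line through [x] and [y] is reached. *)
Lemma affine_hull2 C x y (t : R) : C x -> C y ->
  affine_hull C ((1 - t) *: x + t *: y).
Proof.
move=> Cx Cy; exists 2%N, (fun i => if i == ord0 then 1 - t else t),
  (fun i => if i == ord0 then x else y); split.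
- by move=> i; case: ifP.
- by rewrite !big_ord_recl big_ord0 /= addr0 subrK.
- by rewrite !big_ord_recl big_ord0 /= addr0.
Qed.

(* Let z violate only the k-th constraint.  The segment from the interior point
   x to z leaves C through the face, and shrinking a ball around x towards z
   shows that near the exit point the face fills the hyperplane. *)
Lemma affine_hull_face C K (c : 'I_K -> 'rV[R]_L) (b : 'I_K -> R) (k : 'I_K) x y :
  minimal_description C c b -> interior C x -> dotr (c k) y = b k ->
  affine_hull (face C (c k) (b k)) y.
Proof.
move=> Cmin Cx yk; have [z [z0 zb zk]] := minimal_description_irredundant k Cmin.
have [[c1 c0 b0 CE] _] := Cmin.
have xk : dotr (c k) x < b k.
  have [t t0 /(_ t)] := interior_direction (c k) Cx.
  rewrite gtr0_norm// => /(_ (lexx _)); rewrite CE => -[_ /(_ k)].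
  by rewrite !dotrE -(sqr_enorm (c k)) c1; nra.
have dk : 0 < dotr (c k) z - dotr (c k) x by lra.
pose tau := (b k - dotr (c k) x) / (dotr (c k) z - dotr (c k) x).
have tau0 : 0 < tau by rewrite divr_gt0 // subr_gt0.
have tau1 : tau < 1 by rewrite ltr_pdivrMr //; lra.
have tauE : (1 - tau) * dotr (c k) x + tau * dotr (c k) z = b k.
  by rewrite mulrBl mul1r -addrA -mulNr (addrC (- tau * _)) mulNr -mulrBr divfK
    ?gt_eqF //; ring.
have [p pE] : exists p, p = (1 - tau) *: x + tau *: z by eexists.
have [v vE] : exists v, v = y - p by eexists.
have pk : dotr (c k) p = b k by rewrite pE !dotrE.
have [s s0 hs] := interior_direction v Cx.
have face_p (r : R) : `|r| <= s ->
    face C (c k) (b k) (p + ((1 - tau) * r) *: v).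
  move=> rs; have eqv : p + ((1 - tau) * r) *: v =
      (1 - tau) *: (x + r *: v) + tau *: z.
    by rewrite pE; apply/rowP => l; rewrite !mxE; ring.
  have vk : dotr (c k) v = 0 by rewrite vE dotrDr dotrNr pk yk subrr.
  split; first by rewrite /= dotrDr dotrZr vk pk mulr0 addr0.
  have := hs r rs; rewrite CE => -[w0 wb]; split => [l|j].
    rewrite eqv !mxE; have := w0 l; have := z0 l; rewrite !mxE => zl wl.
    by rewrite addr_ge0 // mulr_ge0 // ?subr_ge0 // ltW.
  have [->|jk] := eqVneq j k; first by rewrite dotrDr dotrZr vk pk mulr0 addr0.
  rewrite eqv dotrDr !(dotrZr _ (c j)).
  by have := wb j; have := zb j jk; nra.
(* [y] lies on the line through two points of the face; its coefficient may exceed 1, so the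
   combination is affine but perhaps not convex. *)
have -> : y = (1 - ((1 - tau) * s)^-1) *: p +
    ((1 - tau) * s)^-1 *: (p + ((1 - tau) * s) *: v).
  rewrite scalerDr scalerA mulVf ?mulf_neq0 ?gt_eqF ?subr_gt0 // scale1r.
  by rewrite addrA -scalerDl subrK scale1r vE addrC subrK.
apply: affine_hull2.
  by have := face_p 0; rewrite mulr0 scale0r addr0 normr0; apply; exact: ltW.
by apply: face_p; rewrite gtr0_norm.
Qed.

(** By [affine_hull_face] the hyperplane lies in the affine hull of the face, so the relative ball
    around [lam] is a full ball of the hyperplane. Halving the radius allows a weak inequality. *)
Lemma relint_face_ball C K (c : 'I_K -> 'rV[R]_L) (b : 'I_K -> R) (k : 'I_K) x lam :
  minimal_description C c b -> interior C x ->
  relint (face C (c k) (b k)) lam ->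
  exists2 e : R, 0 < e &
    forall y, dotr (c k) y = b k -> enorm (y - lam) <= e -> C y.
Proof.
move=> Cmin Cx [_ [e e0 he]]; exists (e / 2) => [|y yk ye].
  by rewrite divr_gt0.
have [//|_ //] := he y (affine_hull_face Cmin Cx yk) _.
by apply: le_lt_trans ye _; rewrite ltr_pdivrMr // ltr_pMr // ltr1n.
Qed.

End Facet.

(** * Negative drift of MaxWeight orthogonally to the facet normal *)

Definition queue_next {L : nat} (q a s : {ffun 'I_L -> nat}) :
  {ffun 'I_L -> nat} := [ffun l => q l + a l - s l]%N.

Section Drift.
Context {R : realType} {L : nat} (calS : {fset {ffun 'I_L -> nat}}).
Implicit Types (q a s : {ffun 'I_L -> nat}) (lam c : 'rV[R]_L).

Lemma dotr_nat_rv q s : dotr (nat_rv q) (nat_rv s) = (dotn q s)%:R :> R.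
Proof. by rewrite natr_sum; apply: eq_bigr => l _; rewrite !mxE natrM. Qed.

Lemma capacity_region_nat_rv s : s \in calS -> capacity_region R calS (nat_rv s).
Proof.
move=> sS; exists 1%N, (fun=> 1), (fun=> nat_rv s); split => //.
- by move=> _; exists s.
- by rewrite big_ord1.
- by rewrite big_ord1 scale1r.
Qed.

(** A linear functional on a convex hull is maximal at a generating point. *)
Lemma mw_argmax_capacity_region q s r : s \in mw_argmax calS q ->
  capacity_region R calS r -> dotr (nat_rv q) r <= dotr (nat_rv q) (nat_rv s).
Proof.
rewrite !inE /= => /andP[_ /allP smax] [n [w [v [vS w0 w1 ->]]]].
rewrite dotr_sumr -[leRHS]mul1r -w1 mulr_suml; apply: ler_sum => i _.
rewrite dotrZr ler_wpM2l //; have [s' /smax s's <-] := vS i.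
by rewrite !dotr_nat_rv ler_nat.
Qed.

Lemma mw_drift c (b delta : R) lam q s : enorm c = 1 ->
  (forall l, 0 <= c 0 l) -> 0 < delta ->
  dotr c lam = b -> dotr c (nat_rv s) <= b ->
  (forall y, dotr c y = b -> enorm (y - lam) <= delta ->
    capacity_region R calS y) ->
  s \in mw_argmax calS q ->
  dotr (perp c (nat_rv q)) (lam - nat_rv s) <=
    - delta * enorm (perp c (nat_rv q)).
Proof.
move=> c1 c0 delta0 clam cs ball sq; set p := perp c _; set V := enorm p.
have V0 : 0 <= V := enorm_ge0 _.
have qp : dotr (nat_rv q) p = V ^+ 2.
  by rewrite sqr_enorm_perp // /p /perp !dotrE (dotrC _ c) expr2.
have [V00|Vneq0] := eqVneq V 0.
  by apply: le_trans (dotr_le_enorm _ _) _; rewrite -/V V00 mul0r mulr0.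
have Vp : 0 < V by rewrite lt_neqAle eq_sym Vneq0.
(* The maximizer [s] is compared with the point of the ball furthest in the direction of [p], whose
   weight exceeds that of [lam] by [delta * V]. *)
have : capacity_region R calS (lam + (delta / V) *: p).
  apply: ball; first by rewrite dotrDr dotrZr dotr_perp // mulr0 addr0.
  by rewrite addrC addKr enormZ gtr0_norm ?divr_gt0 // divfK.
move=> /(mw_argmax_capacity_region sq); rewrite dotrDr dotrZr qp expr2 mulrA divfK //.
(* Replacing [nat_rv q] by its projection subtracts exactly this nonnegative term. *)
have cq : 0 <= dotr c (nat_rv q) * (b - dotr c (nat_rv s)).
  by rewrite mulr_ge0 ?subr_ge0 // dotr_ge0 // => l; rewrite mxE.
by rewrite /p /perp !dotrE clam; lra.
Qed.

End Drift.

(** * Bounded jumps and the change of the squared projected norm in one slot *)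

Section Step.
Context {R : realType} {L : nat} (Amax Smax : nat).
Implicit Types (q a s : {ffun 'I_L -> nat}) (c : 'rV[R]_L).

(** A crude bound for the Euclidean norm of [L] coordinates of size at most [Amax + Smax]; the
    successor makes it at least 1. *)
Definition jump_bound : R := (L * (Amax + Smax)).+1%:R.

Lemma jump_bound_ge1 : 1 <= jump_bound.
Proof. by rewrite ler1n. Qed.

Lemma enorm_le_jump (x : 'rV[R]_L) :
  (forall l, `|x 0 l| <= (Amax + Smax)%:R) -> enorm x <= jump_bound.
Proof.
move=> h; apply: enorm_le; first exact: ler0n.
apply: (@le_trans _ _ (\sum_(l < L) (Amax + Smax)%:R ^+ 2)).
  apply: ler_sum => l _; rewrite -expr2 -(real_normK (num_real _)).
  by rewrite lerXn2r ?nnegrE.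
rewrite sumr_const card_ord -[leLHS]mulr_natr /jump_bound -!natrX -natrM ler_nat.
have : (L <= L ^ 2)%N by case: L => // n; rewrite leq_pmulr.
by move=> /(leq_mul (leqnn ((Amax + Smax) ^ 2)%N)); nia.
Qed.

Variables (q a s : {ffun 'I_L -> nat}).
Hypotheses (a_le : forall l, (a l <= Amax)%N) (s_le : forall l, (s l <= Smax)%N).

Lemma enorm_arrival_service : enorm (nat_rv a - nat_rv s : 'rV[R]_L) <= jump_bound.
Proof.
apply: enorm_le_jump => l; rewrite !mxE ler_norml natrD.
have := a_le l; have := s_le l; rewrite -!(ler_nat R).
by have := ler0n R (a l); have := ler0n R (s l); lra.
Qed.

Lemma queue_next_jump l :
  `|(queue_next q a s l)%:R - (q l)%:R : R| <= (Amax + Smax)%:R.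
Proof.
rewrite ffunE; have := a_le l; have := s_le l.
rewrite ler_norml lerBrDr lerBlDr addrC lerBlDr -!natrD !ler_nat.
lia.
Qed.

Lemma enorm_queue_next :
  enorm (nat_rv (queue_next q a s) - nat_rv q : 'rV[R]_L) <= jump_bound.
Proof. by apply: enorm_le_jump => l; rewrite !mxE queue_next_jump. Qed.

(** The squared projected norm is the squared norm minus the square along [c]. Truncation at 0
    lowers the former relative to [x + z] and, as [c] is nonnegative, raises the component along
    [c]; both effects have the right sign. *)
Lemma queue_next_perp c : enorm c = 1 -> (forall l, 0 <= c 0 l) ->
  enorm (perp c (nat_rv (queue_next q a s))) ^+ 2 <=
  enorm (perp c (nat_rv q)) ^+ 2 +
  2 * dotr (perp c (nat_rv q)) (nat_rv a - nat_rv s) + jump_bound ^+ 2.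
Proof.
move=> c1 c0; rewrite !sqr_enorm_perp //.
set q' := nat_rv (queue_next q a s); set x := nat_rv q; set z := _ - nat_rv s.
have q'z l : x 0 l + z 0 l <= q' 0 l /\ q' 0 l ^+ 2 <= (x 0 l + z 0 l) ^+ 2.
  rewrite !mxE ffunE; have [le_s|lt_s] := leqP (s l) (q l + a l).
    by rewrite natrB // natrD addrA.
  have /eqP -> : (q l + a l - s l == 0)%N by rewrite subn_eq0 ltnW.
  rewrite expr0n /= sqr_ge0; split => //.
  by rewrite addrA subr_le0 -natrD ler_nat ltnW.
have zD : enorm z ^+ 2 <= jump_bound ^+ 2.
  by rewrite lerXn2r ?nnegrE ?enorm_ge0 ?enorm_arrival_service //; exact: ler0n.
clearbody z; rewrite sqr_enorm in zD.
have sq : dotr q' q' <= dotr x x + 2 * dotr x z + jump_bound ^+ 2.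
  apply: (@le_trans _ _ (dotr (x + z) (x + z))).
    by apply: ler_sum => l _; rewrite -!expr2 [(x + z) 0 l]mxE; have [] := q'z l.
  by rewrite dotrDl !dotrDr (dotrC z x); lra.
have lin : dotr c x + dotr c z <= dotr c q'.
  by rewrite -dotrDr; apply: ler_dotr => // l; rewrite [(x + z) 0 l]mxE; have [] := q'z l.
have cx : 0 <= dotr c x by rewrite dotr_ge0 // => l; rewrite mxE.
(* Bounds [dotr c q' ^+ 2] from below by its tangent at [dotr c x], where [lin] and [cx] apply. *)
have : 0 <= (dotr c q' - dotr c x) ^+ 2 by rewrite sqr_ge0.
by rewrite /perp dotrDl dotrNl dotrZl; nra.
Qed.

End Step.

(** * From quadratic drift to exponential drift *)

Section Hajek.
Context {R : realType}.

(** After multiplying by [expR (- x) >= 1 - x], it remains that [(1 + x + 2 * x ^+ 2) * (1 - x) = 1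
    + x ^+ 2 * (1 - 2 * x)] is at least 1. *)
Lemma expR_le_quadratic (x : R) : `|x| <= 2^-1 -> expR x <= 1 + x + 2 * x ^+ 2.
Proof.
rewrite ler_norml => /andP[x1 x2].
rewrite -(ler_pM2r (expR_gt0 (- x))) -expRD subrr expR0.
have := expR_ge1Dx (- x); nra.
Qed.

(** Two regimes meet at [D ^+ 2 / delta]. Below it, one jump stays under the additive constant.
    Above it, the mean increment is at most [- delta / 2], and the quadratic bound gives the factor
    [1 - theta * delta / 2 + 2 * (theta * D) ^+ 2], at most [1 - theta * delta / 4]. *)
Lemma exp_drift (I : Type) (r : seq I) (alpha v' : I -> R) (v delta D theta : R) :
  0 < delta -> 1 <= D -> 0 < theta ->
  theta * D <= 2^-1 -> 8 * theta * D ^+ 2 <= delta -> theta * delta <= 4 ->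
  (forall i, 0 <= alpha i) -> \sum_(i <- r) alpha i = 1 -> 0 <= v ->
  (forall i, alpha i != 0 -> `|v' i - v| <= D) ->
  \sum_(i <- r) alpha i * v' i ^+ 2 <= v ^+ 2 + D ^+ 2 - 2 * delta * v ->
  \sum_(i <- r) alpha i * expR (theta * v' i) <=
    (1 - theta * delta / 4) * expR (theta * v) +
    expR (theta * (D ^+ 2 / delta + D)).
Proof.
move=> delta0 D1 theta0 thetaD thetaD2 thetadelta a0 a1 v0 v'v sq.
have rho0 : 0 <= 1 - theta * delta / 4.
  by rewrite subr_ge0 ler_pdivrMr // mul1r.
have [vB|vB] := ltP v (D ^+ 2 / delta).
  apply: (@le_trans _ _ (expR (theta * (D ^+ 2 / delta + D)))); last first.
    by rewrite lerDr mulr_ge0 ?expR_ge0.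
  rewrite -[leRHS]mul1r -a1 mulr_suml; apply: ler_sum => i _.
  have [->|ai] := eqVneq (alpha i) 0; first by rewrite !mul0r.
  rewrite ler_wpM2l // ler_expR ler_pM2l //.
  by have := v'v i ai; rewrite ler_norml; lra.
apply: (@le_trans _ _ ((1 - theta * delta / 4) * expR (theta * v))); last first.
  by rewrite lerDl expR_ge0.
have D0 : 0 < D by lra.
have vp : 0 < v by apply: lt_le_trans vB; rewrite divr_gt0 // exprn_gt0.
have Dv : D ^+ 2 <= delta * v by rewrite ler_pdivrMr // mulrC in vB.
pose u := \sum_(i <- r) alpha i * (v' i - v).
have u_le : u <= - delta / 2.
  (* Convexity of the square, [2 * v * (v' i - v) <= v' i ^+ 2 - v ^+ 2], turns the quadratic drift
     into a drift of [v] itself. *)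
  have h : 2 * v * u <= - delta * v.
    apply: (@le_trans _ _ (\sum_(i <- r) (alpha i * v' i ^+ 2 - alpha i * v ^+ 2))).
      rewrite /u mulr_sumr; apply: ler_sum => i _.
      by have := mulr_ge0 (a0 i) (sqr_ge0 (v' i - v)); nra.
    rewrite sumrB -mulr_suml a1 mul1r; lra.
  by rewrite -(ler_pM2l (_ : 0 < 2 * v)) ?mulr_gt0 //; lra.
apply: (@le_trans _ _ (\sum_(i <- r) (alpha i * (1 + 2 * (theta * D) ^+ 2) +
    theta * (alpha i * (v' i - v))) * expR (theta * v))).
  apply: ler_sum => i _.
  have [->|ai] := eqVneq (alpha i) 0; first by rewrite !(mul0r, mulr0, addr0).
  have -> : theta * v' i = theta * (v' i - v) + theta * v by ring.
  rewrite expRD mulrA ler_wpM2r ?expR_ge0 //.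
  have -> : alpha i * (1 + 2 * (theta * D) ^+ 2) + theta * (alpha i * (v' i - v)) =
      alpha i * (1 + theta * (v' i - v) + 2 * (theta * D) ^+ 2) by ring.
  have tv : `|theta * (v' i - v)| <= theta * D.
    by rewrite normrM gtr0_norm // ler_pM2l // v'v.
  rewrite ler_wpM2l //; apply: le_trans (expR_le_quadratic (le_trans tv thetaD)) _.
  rewrite lerD2l ler_pM2l // -(real_normK (num_real (theta * (v' i - v)))).
  by rewrite lerXn2r ?nnegrE ?mulr_ge0 // ltW.
rewrite -mulr_suml ler_wpM2r ?expR_ge0 // big_split /= -mulr_suml -mulr_sumr a1 -/u.
nra.
Qed.

End Hajek.

(** * Exponential drift under MaxWeight, with constants independent of [e] *)

Section MaxWeightDrift.
Context {R : realType} {L : nat} (Amax Smax : nat).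
Context (calS : {fset {ffun 'I_L -> nat}}).

(** Here [alpha] is the law of the arrivals in a slot, while the queue [q] and the service [s] are
    held fixed. *)
Lemma mw_exp_drift (c lam : 'rV[R]_L) (b delta theta e : R)
    (q s : {ffun 'I_L -> nat}) (r : seq {ffun 'I_L -> nat})
    (alpha : {ffun 'I_L -> nat} -> R) :
  let D := @jump_bound R L Amax Smax in
  enorm c = 1 -> (forall l, 0 <= c 0 l) -> 0 < delta ->
  dotr c lam = b ->
  (forall y, dotr c y = b -> enorm (y - lam) <= delta ->
    capacity_region R calS y) ->
  0 < theta -> theta * D <= 2^-1 -> 8 * theta * D ^+ 2 <= delta ->
  theta * delta <= 4 ->
  s \in mw_argmax calS q -> (forall l, (s l <= Smax)%N) ->
  dotr c (nat_rv s) <= b ->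
  (forall a, 0 <= alpha a) -> \sum_(a <- r) alpha a = 1 ->
  (forall a, alpha a != 0 -> forall l, (a l <= Amax)%N) ->
  \sum_(a <- r) alpha a *: nat_rv a = lam - e *: c ->
  \sum_(a <- r) alpha a * expR (theta * enorm (perp c (nat_rv (queue_next q a s)))) <=
    (1 - theta * delta / 4) * expR (theta * enorm (perp c (nat_rv q))) +
    expR (theta * (D ^+ 2 / delta + D)).
Proof.
move=> D c1 c0 delta0 clam ball theta0 h1 h2 h3 sq s_le cs a0 a1 a_le am.
apply: exp_drift => //; [exact: jump_bound_ge1|exact: enorm_ge0| |].
- move=> a /a_le {}a_le; rewrite ler_norml lerNl opprB.
  have nx := enorm_queue_next q a_le s_le : enorm (_ : 'rV[R]_L) <= _.
  rewrite !(le_trans (enorm_perp_lipschitz c1 _ _)) //.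
  by rewrite -opprB -scaleN1r enormZ normrN1 mul1r.
- set V := enorm (perp c (nat_rv q)); set p := perp c (nat_rv q).
  apply: (@le_trans _ _ (\sum_(a <- r) (alpha a * (V ^+ 2 + D ^+ 2 - 2 * dotr p (nat_rv s)) +
    2 * dotr p (alpha a *: nat_rv a)))).
    apply: ler_sum => a _; rewrite dotrZr.
    have [->|/a_le {}a_le] := eqVneq (alpha a) 0.
      by rewrite !(mul0r, mulr0, addr0).
    have := queue_next_perp q a_le s_le c1 c0.
    rewrite -/V -/p -/D dotrDr dotrNr => h.
    have := ler_wpM2l (a0 a) h; lra.
  (* Only the mean of the arrivals enters, and its part [e *: c] is orthogonal to [p]. *)
  rewrite big_split /= -mulr_suml a1 -mulr_sumr -dotr_sumr am dotrDr dotrNr dotrZr.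
  rewrite (dotrC p c) dotr_perp //.
  have := mw_drift c1 c0 delta0 clam cs ball sq.
  by rewrite -/V -/p dotrDr dotrNr; lra.
Qed.

Lemma mw_weight_ge0 q s : 0 <= mw_weight R calS q s.
Proof. by rewrite /mw_weight; case: ifP => // _; rewrite invr_ge0. Qed.

(** The inequality also covers an empty argmax, where all weights are 0. *)
Lemma sum_mw_weight_le1 q : \sum_(s <- calS) mw_weight R calS q s <= 1.
Proof.
rewrite -big_mkcond /=; set W := mw_argmax calS q.
rewrite -big_filter (perm_big (enum_fset W)); last first.
  apply: uniq_perm; rewrite ?filter_uniq ?fset_uniq // => s.
  by rewrite mem_filter; apply: andb_idr; rewrite !inE => /andP[].
rewrite big_const_seq count_predT iter_addr_0 -[leLHS]mulr_natl -[size _]/(#|`W|).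
have [->|W0] := eqVneq #|`W| 0%N; first by rewrite mul0r.
by rewrite divff // pnatr_eq0.
Qed.

End MaxWeightDrift.

Lemma drift_exponent (R : realType) (delta D : R) : 0 < delta -> 1 <= D ->
  exists theta : R, [/\ 0 < theta, theta * D <= 2^-1,
    8 * theta * D ^+ 2 <= delta & theta * delta <= 4].
Proof.
move=> delta0 D1; have D0 : 0 < D by lra.
have D2 : 0 < D * delta by rewrite mulr_gt0.
have dd : 0 < delta ^+ 2 by rewrite exprn_gt0.
have DD : 0 < D ^+ 2 by rewrite exprn_gt0.
(* With [theta = delta / M], each summand of [M] secures one of the three upper bounds. *)
pose M := 8 * D ^+ 2 + 2 * (D * delta) + delta ^+ 2.
have M0 : 0 < M by rewrite /M; lra.
exists (delta / M); split.
- by rewrite divr_gt0.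
- by rewrite mulrAC ler_pdivrMr // /M; lra.
- rewrite mulrA mulrAC ler_pdivrMr // /M; nra.
- by rewrite mulrAC ler_pdivrMr // /M; nra.
Qed.

(** * Conditioning and integration for countably valued maps *)

Section DiscreteVariables.
Context {R : realType} {d : measure_display} {T : measurableType d}.
Variable P : probability T R.
Context {Z : countType} (X : T -> Z).
Hypothesis mX : forall z, measurable (X @^-1` [set z]).

Lemma measurable_preimage_countType (B : set Z) : measurable (X @^-1` B).
Proof.
rewrite (_ : _ @^-1` _ = \bigcup_z (X @^-1` [set z] `&` [set _ | B z])).
  apply: countable_bigcupT_measurable => [|z]; first exact: countableP.
  have [Bz|nBz] := pselect (B z).
    by rewrite (_ : [set _ | B z] = setT) ?setIT //; apply/seteqP; split.
  by rewrite (_ : [set _ | B z] = set0) ?setI0 //; apply/seteqP; split.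
by apply/seteqP; split => [w Bw|w [z _ [/= <-]]]; first by exists (X w).
Qed.

(** The codes [choice.pickle] number the atoms of [X], so that countable additivity applies as a
    series over [nat]; codes of no attained value give empty pieces. *)
Lemma measure_countable_partition (E : set T) : measurable E ->
  P E = (\sum_(n <oo) P (E `&` (fun w => choice.pickle (X w)) @^-1` [set n]))%E.
Proof.
move=> mE; rewrite -measure_semi_bigcup.
- by congr (P _); apply/seteqP; split => [w Ew|w [n _ []//]]; exists (choice.pickle (X w)).
- by move=> n; apply: measurableI => //;
    apply: (measurable_preimage_countType (choice.pickle @^-1` [set n])).
- by apply/trivIsetP => i j _ _; apply: contraNeq => /set0P[w [[_ <-] [_ <-]]].
- by apply: bigcupT_measurable => n; apply: measurableI => //;
    apply: (measurable_preimage_countType (choice.pickle @^-1` [set n])).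
Qed.

Lemma preimage_pickle n :
  (exists z, (fun w => choice.pickle (X w)) @^-1` [set n] = X @^-1` [set z]) \/
  (fun w => choice.pickle (X w)) @^-1` [set n] = set0.
Proof.
have [[w wn]|h] := pselect (exists w, choice.pickle (X w) = n); last first.
  by right; apply/seteqP; split => // w wn; case: h; exists w.
left; exists (X w); apply/seteqP; split => [v /= vn|v /= ->//].
by apply: (pcan_inj choice.pickleK); rewrite vn wn.
Qed.

(** Law of total probability: a conditional probability that equals [p] on every atom of [X] equals
    [p] overall. *)
Lemma probability_factor (E F : set T) (p : R) :
  measurable E -> measurable F ->
  (forall z, P (E `&` F `&` X @^-1` [set z]) =
    (P (E `&` X @^-1` [set z]) * p%:E)%E) ->
  P (E `&` F) = (P E * p%:E)%E.
Proof.
move=> mE mF h; rewrite (measure_countable_partition (measurableI _ _ mE mF)).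
rewrite (measure_countable_partition mE) muleC -nneseriesZl //.
apply: eq_eseriesr => n _; rewrite muleC.
by have [[z ->]|->] := preimage_pickle n; rewrite ?h // !setI0 measure0 mul0e.
Qed.

Lemma measure_preimage_null (E : set T) (B : set Z) : measurable E ->
  (forall z, B z -> P (E `&` X @^-1` [set z]) = 0) ->
  P (E `&` X @^-1` B) = 0.
Proof.
move=> mE h; have mB := measurable_preimage_countType B.
rewrite (measure_countable_partition (measurableI _ _ mE mB)).
rewrite eseries0 // => n _ _.
have [[z ->]|->] := preimage_pickle n; last by rewrite setI0 measure0.
have [Bz|nBz] := pselect (B z).
  rewrite -[RHS](h z Bz); congr (P _); apply/seteqP.
  by split => [w [[? ?] ?]|w [Ew /= Xz]] //; split => //; split => //=; rewrite Xz.
rewrite (_ : _ `&` _ = set0) ?measure0 //.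
by apply/seteqP; split => // w [[_ /= Bw] /= zw]; apply: nBz; rewrite -zw.
Qed.

Lemma measurable_fun_countType (E : set T) (f : Z -> R) : measurable E ->
  measurable_fun E (fun w => (f (X w))%:E).
Proof.
move=> mE _ Y mY; apply: measurableI => //.
exact: (measurable_preimage_countType ((fun z => (f z)%:E) @^-1` Y)).
Qed.

(** Values outside [r] form a null event within [E]; the rest is split off value by value. *)
Lemma integral_countType (E : set T) (r : seq Z) (f : Z -> R) :
  measurable E -> uniq r -> (forall z, 0 <= f z) ->
  (forall z, z \notin r -> P (E `&` X @^-1` [set z]) = 0) ->
  (\int[P]_(w in E) (f (X w))%:E =
   (\sum_(z <- r) f z * fine (P (E `&` X @^-1` [set z])))%:E)%E.
Proof.
move=> mE ur f0 rE.
have mX' := measurable_preimage_countType.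
have mfX D mD := @measurable_fun_countType D f mD.
rewrite -[X in (\int[P]_(w in X) _)%E](setIT E).
have -> : [set: T] = X @^-1` [set` r] `|` X @^-1` [set z | z \notin r].
  by apply/seteqP; split => // w _ /=; have [] := boolP (X w \in r); [left|right].
rewrite setIUr ge0_integral_setU //=; [|exact: measurableI..|idtac| |].
- rewrite [X in (_ + X)%E]null_set_integral ?adde0.
  + elim: r ur {rE} => [_|z r IH /= /andP[zr ur]].
      rewrite big_nil (_ : E `&` _ = set0) ?integral_set0 //.
      by apply/seteqP; split => // w [].
    rewrite big_cons EFinD -IH //.
    have -> : E `&` X @^-1` [set` z :: r] =
        (E `&` X @^-1` [set z]) `|` (E `&` X @^-1` [set` r]).
      rewrite -setIUr -preimage_setU; congr (_ `&` _ @^-1` _).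
      apply/seteqP; split => y /=; rewrite inE.
        by move=> /orP[/eqP|]; [left|right].
      by move=> [->|->]; rewrite ?eqxx ?orbT.
    rewrite ge0_integral_setU //=; [|exact: measurableI..|idtac| |].
    * congr (_ + _)%E; rewrite (eq_integral (cst (f z)%:E)); last first.
        by move=> w; rewrite inE => -[_ /= ->].
      rewrite integral_cst; last exact: measurableI.
      by rewrite EFinM fineK // fin_num_measure //; exact: measurableI.
    * by apply: mfX; apply: measurableU; apply: measurableI.
    * by move=> w _; rewrite lee_fin.
    * apply/disj_setPS => w [[_ /= Xz] [_ /= Xr]].
      by move: zr; rewrite -Xz Xr.
  + exact: measurableI.
  + by apply: mfX; apply: measurableI.
  + exact: measure_preimage_null.
- by apply: mfX; apply: measurableU; apply: measurableI.
- by move=> w _; rewrite lee_fin.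
- by apply/disj_setPS => w [[_ /= Xr] [_ /= /negP]].
Qed.

End DiscreteVariables.

(** * Joint law of the arrivals *)

Section MaxWeightLaw.
Context {R : realType} {d : measure_display} {T : measurableType d}.
Context {P : probability T R} {L : nat}.
Implicit Types (q a s : {ffun 'I_L -> nat}).

Lemma measurable_vec (X : 'I_L -> {RV P >-> nat}) q :
  measurable (vec X @^-1` [set q]).
Proof.
rewrite (_ : _ @^-1` _ = \bigcap_(l in setT) (X l @^-1` [set q l])).
  apply: fin_bigcap_measurable => [|l _]; first exact: finite_finset.
  exact: measurable_funPTI.
apply/seteqP; split => [w /= <- l _ /=|w h]; first by rewrite ffunE.
by apply/ffunP => l; rewrite ffunE; apply: h.
Qed.

Lemma mutually_independent_seq (I : choiceType) (X : I -> {RV P >-> nat})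
    (r : seq I) (x : I -> nat) : mutually_independent X -> uniq r ->
  P [set w | forall i, i \in r -> X i w = x i] =
  (\prod_(i <- r) P (X i @^-1` [set x i]))%E.
Proof.
move=> indep ur; have := indep [fset i in r]%fset (fun i => [set x i]) (fun _ _ => Logic.I).
have -> : \bigcap_(i in [set` [fset i in r]%fset]) X i @^-1` [set x i] =
    [set w | forall i, i \in r -> X i w = x i].
  by apply/seteqP; split => w h i; have := h i; rewrite /= inE.
move=> ->; apply: perm_big; apply: uniq_perm; rewrite ?fset_uniq // => i.
by rewrite inE.
Qed.

Definition arrival_path (A : nat -> 'I_L -> {RV P >-> nat}) n
    (a : nat -> {ffun 'I_L -> nat}) : set T :=
  [set w | forall u, (u < n)%N -> vec (A u) w = a u].

(** Both events prescribe finitely many coordinates [(u, l)], over disjoint lists of slots, so the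
    product formula for the whole family factors. *)
Lemma arrival_path_next Amax (lam : 'rV[R]_L) A n
    (a : nat -> {ffun 'I_L -> nat}) :
  arrival_process Amax lam A ->
  P (arrival_path A n.+1 a) = (P (arrival_path A n a) * P (vec (A n) @^-1` [set a n]))%E.
Proof.
case=> _ indep _ _; pose x (ul : nat * 'I_L) := a ul.1 ul.2.
pose slots m k := [seq (u, l) | u <- iota m k, l <- enum 'I_L].
have slots_uniq m k : uniq (slots m k).
  by apply: allpairs_uniq; rewrite ?iota_uniq ?enum_uniq // => -[? ?] [? ?] _ _ [-> ->].
have pathE m k : [set w | forall u, (m <= u < m + k)%N -> vec (A u) w = a u] =
    [set w | forall ul, ul \in slots m k -> A ul.1 ul.2 w = x ul].
  apply/seteqP; split => w h => [_ /allpairsP[[u l] /= [um _ ->]]|u um].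
    by rewrite mem_iota in um; rewrite /x /= -h // ffunE.
  apply/ffunP => l; rewrite ffunE; apply: (h (u, l)).
  by rewrite allpairs_f // ?mem_iota // mem_enum.
have probE m k := mutually_independent_seq x indep (slots_uniq m k).
have -> : arrival_path A n.+1 a =
  [set w | forall u, (0 <= u < 0 + n.+1)%N -> vec (A u) w = a u] by [].
have -> : arrival_path A n a =
  [set w | forall u, (0 <= u < 0 + n)%N -> vec (A u) w = a u] by [].
have -> : vec (A n) @^-1` [set a n] =
    [set w | forall u, (n <= u < n + 1)%N -> vec (A u) w = a u].
  rewrite addn1; apply/seteqP; split => w /= h => [u|]; last by apply: h; rewrite leqnn ltnS /=.
  by rewrite ltnS -eqn_leq => /eqP <-.
rewrite !pathE !probE -big_cat /=; congr (\big[_/_]_(i <- _) _).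
by rewrite /slots -addn1 iotaD allpairs_cat.
Qed.

End MaxWeightLaw.

(** * One-step transition law of the MaxWeight system *)

Fixpoint queue_trajectory {L : nat} (q0 : {ffun 'I_L -> nat})
    (a s : nat -> {ffun 'I_L -> nat}) (u : nat) : {ffun 'I_L -> nat} :=
  if u is u'.+1 then queue_next (queue_trajectory q0 a s u') (a u') (s u') else q0.

Section SystemLaw.
Context {R : realType} {d : measure_display} {T : measurableType d}.
Context {P : probability T R} {L : nat} {calS : {fset {ffun 'I_L -> nat}}}.
Context {Amax : nat} {lam : 'rV[R]_L} {A S Q : nat -> 'I_L -> {RV P >-> nat}}.
Hypotheses (arr : arrival_process Amax lam A) (sys : mw_system calS A S Q).

Lemma vec_queue_next t w :
  vec (Q t.+1) w = queue_next (vec (Q t) w) (vec (A t) w) (vec (S t) w).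
Proof. by apply/ffunP => l; rewrite !ffunE (queue_step sys). Qed.

Lemma history_queue n t q0 a s w u : history A S Q n t q0 a s w ->
  (u <= n)%N -> (u <= t)%N -> vec (Q u) w = queue_trajectory q0 a s u.
Proof.
move=> [Q0 An St]; elim: u => [//|u IH] un ut.
by rewrite vec_queue_next IH ?An ?St // ltnW.
Qed.

(** Chain rule over the services: a history already determines [Q t], so the conditioning on [Q t]
    in [mw_policy] adds nothing. *)
Lemma probability_history n t q0 a s : (t <= n)%N ->
  P (history A S Q n t q0 a s) =
  (P (vec (Q 0%N) @^-1` [set q0]) * P (arrival_path A n a) *
   (\prod_(u < t) mw_weight R calS (queue_trajectory q0 a s u) (s u))%:E)%E.
Proof.
elim: t => [_|t IH tn].
  rewrite big_ord0 mule1 -(queue_initial sys); congr (P _).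
  by apply/seteqP; split => w; [move=> []|move=> [? ?]; split].
rewrite big_ord_recr /= EFinM muleA -IH ?(ltnW tn) //.
have := mw_policy sys n t q0 a s (queue_trajectory q0 a s t).
have -> : history A S Q n t q0 a s `&`
    [set w | vec (Q t) w = queue_trajectory q0 a s t] = history A S Q n t q0 a s.
  by apply/seteqP; split => [w []//|w h]; split => //=;
    rewrite (history_queue h) // ltnW.
move=> /= <-; congr (P _); apply/seteqP; split => w.
  move=> [Q0 An St]; split; last exact: St.
  by split => // u ut; apply: St; rewrite ltnW.
move=> [[Q0 An St] /= Sn]; split => // u; rewrite ltnS leq_eqVlt.
by move=> /orP[/eqP->//|]; exact: St.
Qed.

(** The whole past as a single value in a countable type, so that conditioning on it becomes a sum
    over atoms. *)
Definition past t w := (vec (Q 0%N) w,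
  [seq (vec (A u) w, vec (S u) w) | u <- iota 0 t]).

(** From slot [t] on the default [a] is returned: it serves as the prescribed arrival of the current
    slot. *)
Let hist_a (h : seq ({ffun 'I_L -> nat} * {ffun 'I_L -> nat})) t a u :=
  if (u < t)%N then (nth (a, a) h u).1 else a.
Let hist_s (h : seq ({ffun 'I_L -> nat} * {ffun 'I_L -> nat})) t s u :=
  if (u < t)%N then (nth (s, s) h u).2 else s.

Lemma past_history t q0 h a s w : size h = t ->
  (past t w = (q0, h)) <-> history A S Q t t q0 (hist_a h t a) (hist_s h t s) w.
Proof.
move=> ht; split.
  move=> [Q0 hE]; split => // u ut; rewrite /hist_a /hist_s ut -hE.
    by rewrite (nth_map 0%N) ?size_iota // nth_iota.
  by rewrite (nth_map 0%N) ?size_iota // nth_iota.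
move=> [Q0 hA hS]; congr (_, _) => //.
apply: (@eq_from_nth _ (a, s)); first by rewrite size_map size_iota.
move=> u; rewrite size_map size_iota => ut.
rewrite (nth_map 0%N) ?size_iota // nth_iota // add0n hA // hS //.
rewrite /hist_a /hist_s ut.
rewrite !(set_nth_default (a, s)) ?ht //.
by case: nth.
Qed.

Lemma measurable_past t z : measurable (past t @^-1` [set z]).
Proof.
pose x0 : {ffun 'I_L -> nat} := [ffun => 0%N].
have mpast : forall t h,
    measurable ((fun w => [seq (vec (A u) w, vec (S u) w) | u <- iota 0 t])
      @^-1` [set h]).
  move=> {}t h.
  have [ht|ht] := eqVneq (size h) t; last first.
    rewrite (_ : _ @^-1` _ = set0) //; apply/seteqP; split => // w /= hE.
    by move: ht; rewrite -hE size_map size_iota eqxx.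
  rewrite (_ : _ @^-1` _ = \bigcap_(u in [set u | (u < t)%N])
     (vec (A u) @^-1` [set hist_a h t x0 u] `&`
      vec (S u) @^-1` [set hist_s h t x0 u])).
    apply: bigcap_measurableType => u _.
    by apply: measurableI; exact: measurable_vec.
  apply/seteqP; split => w.
    move=> /= hE u /= ut.
    have [_ hA hS] : history A S Q t t (vec (Q 0%N) w) (hist_a h t x0) (hist_s h t x0) w.
      by apply/past_history => //; rewrite /past hE.
    by split; rewrite /= ?hA ?hS.
  move=> hu; have : past t w = (vec (Q 0%N) w, h).
    by apply/(past_history _ x0 x0 _ ht); split => // u ut; have [] := hu u ut.
  by case.
case: z => q0 h.
rewrite (_ : _ @^-1` _ = vec (Q 0%N) @^-1` [set q0] `&`
  (fun w => [seq (vec (A u) w, vec (S u) w) | u <- iota 0 t]) @^-1` [set h]).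
  by apply: measurableI; [exact: measurable_vec|exact: mpast].
by apply/seteqP; split => w; [move=> [/= -> ->]|move=> [/= <- <-]].
Qed.

(* Given the whole past, Q t is determined, A t is fresh, and S t is drawn from
   the argmax; averaging over the past gives the one-step transition law. *)
Lemma one_step_law (B : set {ffun 'I_L -> nat}) t q a s :
  P ((vec (Q 0%N) @^-1` B `&` vec (Q t) @^-1` [set q]) `&`
     (vec (A t) @^-1` [set a] `&` vec (S t) @^-1` [set s])) =
  (P (vec (Q 0%N) @^-1` B `&` vec (Q t) @^-1` [set q]) *
   (fine (P (vec (A t) @^-1` [set a])) * mw_weight R calS q s)%:E)%E.
Proof.
have mB : measurable (vec (Q 0%N) @^-1` B).
  by apply: measurable_preimage_countType => z; exact: measurable_vec.
apply: (probability_factor (measurable_past t)).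
- by apply: measurableI => //; exact: measurable_vec.
- by apply: measurableI; exact: measurable_vec.
move=> [q0 h]; set E := _ `&` vec (Q t) @^-1` _; set F := _ `&` vec (S t) @^-1` _.
(* Pasts of the wrong length, starting outside [B] or leading to a queue other than [q] contribute 0
   to both sides. *)
have zero : E `&` past t @^-1` [set (q0, h)] = set0 ->
  P (E `&` F `&` past t @^-1` [set (q0, h)]) =
  (P (E `&` past t @^-1` [set (q0, h)]) *
    (fine (P (vec (A t) @^-1` [set a])) * mw_weight R calS q s)%:E)%E.
  by rewrite (setIC E F) -setIA => ->; rewrite setI0 measure0 mul0e.
have [ht|ht] := eqVneq (size h) t; last first.
  apply: zero; apply/seteqP; split => // w [_ /= [_ hE]].
  by move: ht; rewrite -hE size_map size_iota eqxx.
have pastE w : past t w = (q0, h) <-> _ := past_history q0 a s w ht.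
set a' := hist_a h t a in pastE; set s' := hist_s h t s in pastE.
have [Bq0|nBq0] := pselect (B q0); last first.
  by apply: zero; apply/seteqP; split => // w [[/= BQ _] /= [Q0 _]];
    apply: nBq0; rewrite -Q0.
have [qE|qE] := eqVneq q (queue_trajectory q0 a' s' t); last first.
  apply: zero; apply/seteqP; split => // w [[_ /= Qq] /= /pastE/history_queue].
  by move=> /(_ t (leqnn _) (leqnn _)); rewrite Qq => qE'; rewrite qE' eqxx in qE.
have a't : a' t = a by rewrite /a' /hist_a ltnn.
have s't : s' t = s by rewrite /s' /hist_s ltnn.
have histE : E `&` past t @^-1` [set (q0, h)] = history A S Q t t q0 a' s'.
  apply/seteqP; split => w; first by move=> [_ /pastE].
  move=> hw; split; last exact/pastE.
  split; first by have [/= ->] := hw.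
  by rewrite /= (history_queue hw) // qE.
(* The arrival horizon is [t.+1] but the service horizon only [t]: the current arrival is part of
   the conditioning when [S t] is drawn. *)
have histEF : E `&` F `&` past t @^-1` [set (q0, h)] =
    history A S Q t.+1 t q0 a' s' `&` [set w | vec (Q t) w = q] `&`
      [set w | vec (S t) w = s' t].
  rewrite setIAC histE; apply/seteqP; split => w.
    move=> [hw [/= At St]]; rewrite s't; split => //; split; last first.
      by rewrite /= (history_queue hw) // qE.
    have [Q0 hA hS] := hw; split => // u; rewrite ltnS leq_eqVlt.
    by move=> /orP[/eqP ->|]; [rewrite a't|exact: hA].
  move=> [[[Q0 hA hS] _] /= St]; split; first by split => // u ut; rewrite hA // ltnW.
  by split; rewrite /= -?a't -?s't // hA.
rewrite histEF histE (mw_policy sys).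
have -> : history A S Q t.+1 t q0 a' s' `&` [set w | vec (Q t) w = q] =
    history A S Q t.+1 t q0 a' s'.
  by apply/seteqP; split => [w []//|w hw]; split => //=; rewrite (history_queue hw) // qE.
rewrite !probability_history // (arrival_path_next _ _ arr) a't s't EFinM fineK; last first.
  by rewrite fin_num_measure //; exact: measurable_vec.
rewrite -!muleA; congr (_ * (_ * _))%E; rewrite !muleA; congr (_ * _)%E.
by rewrite muleC.
Qed.

End SystemLaw.

(** * Expectations over the queues as finite sums, and their geometric recursion *)

Section Box.
Context {L : nat}.

(** A duplicate-free list, because the finite sums range over vectors of an infinite type. *)
Definition box (N : nat) : seq {ffun 'I_L -> nat} :=
  undup [seq [ffun l => nat_of_ord (g l)] | g : {ffun 'I_L -> 'I_N.+1}].

Lemma mem_box N (q : {ffun 'I_L -> nat}) : (forall l, (q l <= N)%N) -> q \in box N.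
Proof.
move=> qN; rewrite mem_undup; apply/fintype.imageP; exists [ffun l => inord (q l)] => //.
by apply/ffunP => l; rewrite !ffunE inordK // ltnS.
Qed.

End Box.

Section QueueExpectation.
Context {R : realType} {d : measure_display} {T : measurableType d}.
Context {P : probability T R} {L : nat} {calS : {fset {ffun 'I_L -> nat}}}.
Context {Amax : nat} {lam : 'rV[R]_L} {A S Q : nat -> 'I_L -> {RV P >-> nat}}.
Hypotheses (arr : arrival_process Amax lam A) (sys : mw_system calS A S Q).
Implicit Types (q a s : {ffun 'I_L -> nat}).

Definition arrival_weight t a : R := fine (P (vec (A t) @^-1` [set a])).

Lemma arrival_weight_ge0 t a : 0 <= arrival_weight t a.
Proof. by rewrite fine_ge0. Qed.

Lemma arrival_weight_le t a : arrival_weight t a != 0 -> forall l, (a l <= Amax)%N.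
Proof.
move=> a0 l; rewrite leqNgt; apply: contraNN a0 => al.
rewrite /arrival_weight (_ : _ @^-1` _ = set0) ?measure0 //.
apply/seteqP; split => // w /= wa; move: al.
by rewrite -wa ffunE ltnNge (arrival_bounded arr).
Qed.

Lemma arrival_notin_box t a : a \notin box Amax ->
  P (vec (A t) @^-1` [set a]) = 0.
Proof.
move=> aN; rewrite (_ : _ @^-1` _ = set0) ?measure0 //.
apply/seteqP; split => // w /= wa; move: aN; rewrite -wa mem_box // => l.
by rewrite ffunE (arrival_bounded arr).
Qed.

Lemma integral_arrival t (f : {ffun 'I_L -> nat} -> R) : (forall a, 0 <= f a) ->
  (\int[P]_w (f (vec (A t) w))%:E =
   (\sum_(a <- box Amax) f a * arrival_weight t a)%:E)%E.
Proof.
move=> f0; rewrite (integral_countType (measurable_vec (A t)) _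
  (undup_uniq _ : uniq (box Amax)) f0) //.
  by under eq_bigr do rewrite setTI.
by move=> a aN; rewrite setTI arrival_notin_box.
Qed.

Lemma sum_arrival_weight t : \sum_(a <- box Amax) arrival_weight t a = 1.
Proof.
have := @integral_arrival t (fun=> 1) (fun=> ler01).
rewrite integral_cst // mul1e; have -> : (P : measure T R) setT = 1%E by exact: probability_setT.
by under eq_bigr do rewrite mul1r; case.
Qed.

Lemma sum_arrival_mean t :
  \sum_(a <- box Amax) arrival_weight t a *: nat_rv a = lam.
Proof.
apply/rowP => l; rewrite summxE.
have := arrival_mean arr t l; rewrite unlock.
have := @integral_arrival t (fun a => (a l)%:R) (fun=> ler0n _ _).
under eq_integral do rewrite ffunE.
move=> -> [<-]; apply: eq_bigr => a _.
by rewrite !mxE mulrC.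
Qed.

(** The initial law is arbitrary and may lack exponential moments; on this event [Q t] takes
    finitely many values. *)
Definition initial_le m : set T := vec (Q 0%N) @^-1` [set q | forall l, (q l <= m)%N].

Lemma measurable_initial_le m : measurable (initial_le m).
Proof. by apply: measurable_preimage_countType; exact: measurable_vec. Qed.

Lemma queue_le m t w l : initial_le m w -> (Q t l w <= m + t * Amax)%N.
Proof.
move=> Q0; elim: t => [|t IH]; first by have := Q0 l; rewrite ffunE addn0.
rewrite (queue_step sys) (leq_trans (leq_subr _ _)) // mulSnr addnA leq_add //.
exact: (arrival_bounded arr).
Qed.

Lemma queue_notin_box m t q : q \notin box (m + t * Amax) ->
  P (initial_le m `&` vec (Q t) @^-1` [set q]) = 0.
Proof.
move=> qN; rewrite (_ : _ `&` _ = set0) ?measure0 //.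
apply/seteqP; split => // w [Q0 /= wq]; move: qN; rewrite -wq mem_box // => l.
by rewrite ffunE queue_le.
Qed.

Definition queue_weight m t q : R :=
  fine (P (initial_le m `&` vec (Q t) @^-1` [set q])).

Lemma queue_weight_ge0 m t q : 0 <= queue_weight m t q.
Proof. by rewrite fine_ge0. Qed.

Lemma integral_queue m t (f : {ffun 'I_L -> nat} -> R) : (forall q, 0 <= f q) ->
  (\int[P]_(w in initial_le m) (f (vec (Q t) w))%:E =
   (\sum_(q <- box (m + t * Amax)) f q * queue_weight m t q)%:E)%E.
Proof.
move=> f0; rewrite (integral_countType (measurable_vec (Q t)) _
  (undup_uniq _ : uniq (box (m + t * Amax))) f0) //.
  exact: measurable_initial_le.
by move=> q; exact: queue_notin_box.
Qed.

Lemma sum_queue_weight_le1 m t :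
  \sum_(q <- box (m + t * Amax)) queue_weight m t q <= 1.
Proof.
have := @integral_queue m t (fun=> 1) (fun=> ler01).
rewrite integral_cst; last exact: measurable_initial_le.
rewrite mul1e => PE; rewrite -lee_fin (eq_bigr (fun q => 1 * queue_weight m t q)).
  by rewrite -PE probability_le1 //; exact: measurable_initial_le.
by move=> q _; rewrite mul1r.
Qed.

(** By [one_step_law], the joint law of [Q t], [A t] and [S t] on [initial_le m] is a product of the
    three weights. *)
Lemma integral_queue_next m t (f : {ffun 'I_L -> nat} -> R) : (forall q, 0 <= f q) ->
  (\int[P]_(w in initial_le m) (f (vec (Q t.+1) w))%:E =
   (\sum_(q <- box (m + t * Amax)) queue_weight m t q *
     (\sum_(s <- calS) mw_weight R calS q s *
       (\sum_(a <- box Amax) arrival_weight t a * f (queue_next q a s))))%:E)%E.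
Proof.
move=> f0.
pose X w := (vec (Q t) w, (vec (A t) w, vec (S t) w)).
pose g (z : {ffun 'I_L -> nat} * ({ffun 'I_L -> nat} * {ffun 'I_L -> nat})) :=
  f (queue_next z.1 z.2.1 z.2.2).
have XE z : X @^-1` [set z] = vec (Q t) @^-1` [set z.1] `&`
    (vec (A t) @^-1` [set z.2.1] `&` vec (S t) @^-1` [set z.2.2]).
  case: z => q [a s]; apply/seteqP; split => w /=; first by move=> [<- <- <-].
  by move=> [<- [<- <-]].
have mX z : measurable (X @^-1` [set z]).
  by rewrite XE; apply: measurableI; [|apply: measurableI]; exact: measurable_vec.
have PX z : P (initial_le m `&` X @^-1` [set z]) =
    (queue_weight m t z.1 * (arrival_weight t z.2.1 * mw_weight R calS z.1 z.2.2))%:E.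
  rewrite XE setIA (one_step_law arr sys) [RHS]EFinM fineK // fin_num_measure //.
  by apply: measurableI; [exact: measurable_initial_le|exact: measurable_vec].
rewrite (eq_integral (fun w => (g (X w))%:E)); last first.
  by move=> w _; rewrite (vec_queue_next sys).
pose r := [seq (q, x) | q <- box (m + t * Amax),
  x <- [seq (a, s) | a <- box Amax, s <- enum_fset calS]].
rewrite (@integral_countType _ _ _ P _ X mX _ r).
- congr EFin; rewrite big_allpairs_dep; apply: eq_bigr => q _ /=.
  rewrite big_allpairs_dep exchange_big mulr_sumr; apply: eq_bigr => s _ /=.
  rewrite !mulr_sumr; apply: eq_bigr => a _.
  by rewrite PX /= /g /=; ring.
- exact: measurable_initial_le.
- apply: allpairs_uniq; rewrite ?undup_uniq //; last by move=> [? ?] [? ?] _ _ [-> ->].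
  apply: allpairs_uniq; rewrite ?undup_uniq ?fset_uniq //.
  by move=> [? ?] [? ?] _ _ [-> ->].
- by move=> z; exact: f0.
(* Outside [r] at least one of the three weights vanishes. *)
move=> [q [a s]] zr; rewrite PX /=.
have [qb|/queue_notin_box] := boolP (q \in box (m + t * Amax)); last first.
  by rewrite /queue_weight => ->; rewrite mul0r.
have [ab|/(arrival_notin_box t)] := boolP (a \in box Amax); last first.
  by rewrite /arrival_weight => ->; rewrite mul0r mulr0.
rewrite /mw_weight; case: ifPn => [|_]; last by rewrite !mulr0.
rewrite !inE => /andP[sS _]; move: zr.
by rewrite allpairs_f // allpairs_f.
Qed.

Variables (f : {ffun 'I_L -> nat} -> R) (rho C : R).
Hypotheses (f0 : forall q, 0 <= f q) (rho0 : 0 <= rho) (C0 : 0 <= C).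
Hypothesis f_drift : forall t q s, s \in mw_argmax calS q ->
  \sum_(a <- box Amax) arrival_weight t a * f (queue_next q a s) <= rho * f q + C.

Definition queue_mean m t : R :=
  \sum_(q <- box (m + t * Amax)) f q * queue_weight m t q.

(** The drift bound is averaged over the services and then over the queues; both total masses are at
    most 1. *)
Lemma queue_mean_next m t : queue_mean m t.+1 <= rho * queue_mean m t + C.
Proof.
rewrite -lee_fin -(integral_queue _ _ f0) integral_queue_next // lee_fin.
apply: (@le_trans _ _ (\sum_(q <- box (m + t * Amax))
    queue_weight m t q * (rho * f q + C))).
  apply: ler_sum => q _; rewrite ler_wpM2l ?queue_weight_ge0 //.
  apply: (@le_trans _ _ (\sum_(s <- calS) mw_weight R calS q s * (rho * f q + C))).
    apply: ler_sum => s _; have [sq|sq] := boolP (s \in mw_argmax calS q).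
      by rewrite ler_wpM2l ?mw_weight_ge0 ?f_drift.
    by rewrite /mw_weight (negbTE sq) !mul0r.
  rewrite -mulr_suml ler_piMl ?sum_mw_weight_le1 //.
  by rewrite addr_ge0 ?mulr_ge0.
under eq_bigr do rewrite mulrDr.
rewrite big_split /= lerD //.
  rewrite mulr_sumr; apply: ler_sum => q _.
  by rewrite mulrCA (mulrC (f q)).
by rewrite -mulr_suml ler_piMl ?sum_queue_weight_le1.
Qed.

(** [C / (1 - rho)] is the fixed point of the recursion; the dependence on [m] sits in a term that
    decays geometrically. *)
Lemma queue_mean_bound m t : rho < 1 ->
  queue_mean m t <= queue_mean m 0 * rho ^+ t + C / (1 - rho).
Proof.
move=> rho1; have r1 : 0 < 1 - rho by rewrite subr_gt0.
elim: t => [|t IH].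
  by rewrite expr0 mulr1 lerDl divr_ge0 // ltW.
apply: le_trans (queue_mean_next m t) _.
apply: (@le_trans _ _ (rho * (queue_mean m 0 * rho ^+ t + C / (1 - rho)) + C)).
  by rewrite lerD2r ler_wpM2l.
have : C / (1 - rho) = rho * (C / (1 - rho)) + C.
  by field; rewrite gt_eqF.
by rewrite exprS; lra.
Qed.

End QueueExpectation.

(** * Regularity of the projected norm, and powers against exponentials *)

Section PerpRegularity.
Context {R : realType} {L : nat}.

Lemma continuous_enorm_perp (c : 'rV[R]_L) :
  continuous (fun x : 'rV[R]_L => enorm (perp c x)).
Proof.
have sum_cont (F : 'I_L -> 'rV[R]_L -> R) : (forall l, continuous (F l)) ->
    continuous (fun x => \sum_(l < L) F l x).
  by move=> Fc; apply: continuous_big => //; exact: add_continuous.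
have perp_cont l : continuous (fun x : 'rV[R]_L => perp c x 0 l).
  rewrite (_ : (fun x => _) = fun x : 'rV[R]_L =>
    x 0 l - (\sum_(j < L) c 0 j * x 0 j) * c 0 l); last first.
    by apply/funext => x; rewrite !mxE.
  move=> x; apply: (@continuousB _ _ _ (fun x : 'rV[R]_L => x 0 l)).
    exact: coord_continuous.
  apply: (@continuousM _ _ (fun x : 'rV[R]_L => \sum_(j < L) c 0 j * x 0 j)).
    apply: sum_cont => j y.
    apply: (@continuousM _ _ (fun=> c 0 j) (fun y : 'rV[R]_L => y 0 j)).
      exact: cst_continuous.
    exact: coord_continuous.
  exact: cst_continuous.
move=> x; apply: (@continuous_comp _ _ _ (fun y : 'rV[R]_L => dotr (perp c y) (perp c y))).
  by apply: sum_cont => l y; apply: continuousM; exact: perp_cont.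
exact: sqrt_continuous.
Qed.

Lemma measurable_enorm_perp {d : measure_display} {T : measurableType d}
    {P : probability T R} (Y : 'I_L -> {RV P >-> R}) (c : 'rV[R]_L) :
  measurable_fun setT (fun w => enorm (perp c (rvec Y w))).
Proof.
have perp_meas l : measurable_fun setT (fun w => perp c (rvec Y w) 0 l).
  rewrite (_ : (fun w => _) = fun w =>
    Y l w - (\sum_(j < L) c 0 j * Y j w) * c 0 l); last first.
    apply/funext => w; rewrite !mxE; congr (_ - _ * _).
    by apply: eq_bigr => j _; rewrite mxE.
  apply: measurable_funB => //; apply: measurable_funM => //.
  by apply: measurable_sum => j; apply: measurable_funM.
apply: (@measurableT_comp _ _ _ _ _ _ (@Num.sqrt R)).
  by apply: continuous_measurable_fun; exact: sqrt_continuous.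
by apply: measurable_sum => l; apply: measurable_funM.
Qed.

End PerpRegularity.

(** The inequality [u <= expR u] at [u = theta * v / r%:R], raised to the power [r]. *)
Lemma expr_le_expR (R : realType) (theta v : R) (r : nat) : 0 < theta -> 0 <= v ->
  (0 < r)%N -> v ^+ r <= (r%:R / theta) ^+ r * expR (theta * v).
Proof.
move=> theta0 v0 r0; have rp : 0 < r%:R :> R by rewrite ltr0n.
pose u := theta * v / r%:R.
have vE : v = r%:R / theta * u by rewrite /u; field; rewrite !gt_eqF.
have tvE : theta * v = r%:R * u by rewrite /u [RHS]mulrC divfK // gt_eqF.
have rt0 : 0 <= r%:R / theta by rewrite divr_ge0 // ltW.
rewrite tvE expRM_natl -exprMn lerXn2r ?nnegrE //.
  by rewrite mulr_ge0 ?expR_ge0.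
rewrite [leLHS]vE ler_wpM2l //; apply: le_trans (expR_ge1Dx _).
by rewrite lerDr.
Qed.

(** * Passage to the limit distribution *)

Section SteadyState.
Context {R : realType} {d d' : measure_display}.
Context {T : measurableType d} {T' : measurableType d'}.
Context {P : probability T R} {P' : probability T' R} {L : nat}.
Context {calS : {fset {ffun 'I_L -> nat}}} {Amax : nat} {lam : 'rV[R]_L}.
Context {A S Q : nat -> 'I_L -> {RV P >-> nat}} {Y : 'I_L -> {RV P' >-> R}}.
Hypotheses (arr : arrival_process Amax lam A) (sys : mw_system calS A S Q).

Lemma initial_le_cvg : (fun m => P (initial_le (Q := Q) m)) @ \oo --> 1%E.
Proof.
have <- : (P : measure T R) setT = 1%E by exact: probability_setT.
have -> : [set: T] = \bigcup_m initial_le (Q := Q) m.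
  apply/seteqP; split => // w _; exists (\max_(l < L) Q 0%N l w)%N => // l.
  by rewrite ffunE; apply: (@leq_bigmax _ (fun l => Q 0%N l w)).
apply: nondecreasing_cvg_mu.
- exact: measurable_initial_le.
- by apply: bigcupT_measurable; exact: measurable_initial_le.
- move=> m n mn; apply/subsetPset => w h l; exact: leq_trans (h l) mn.
Qed.

Variables (f : {ffun 'I_L -> nat} -> R) (rho C : R).
Hypotheses (f0 : forall q, 0 <= f q) (rho0 : 0 <= rho) (C0 : 0 <= C) (rho1 : rho < 1).
Hypothesis f_drift : forall t q s, s \in mw_argmax calS q ->
  \sum_(a <- box Amax) arrival_weight (A := A) t a * f (queue_next q a s) <=
    rho * f q + C.
Hypothesis limQ :
  cvg_in_distribution P P' (fun t w => nat_rv (vec (Q t) w)) (rvec Y).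

(** On [initial_le m] the drift bound applies through [h <= kappa * f]; off it, [h] is bounded by
    [M]. *)
Lemma expectation_truncated m t (h : {ffun 'I_L -> nat} -> R) (M kappa : R) :
  (forall q, 0 <= h q) -> (forall q, h q <= M) -> 0 <= kappa ->
  (forall q, h q <= kappa * f q) ->
  (\int[P]_w (h (vec (Q t) w))%:E <=
    (kappa * (queue_mean (Amax := Amax) (Q := Q) f m 0 * rho ^+ t + C / (1 - rho)) +
     M * (1 - fine (P (initial_le (Q := Q) m))))%:E)%E.
Proof.
move=> h0 hM kappa0 hf.
have mE := measurable_initial_le (Q := Q) m; set E := initial_le m in mE *.
have mh D : measurable D -> measurable_fun D (fun w => (h (vec (Q t) w))%:E).
  by apply: measurable_fun_countType; exact: measurable_vec.
rewrite -(setUv E) ge0_integral_setU //=; last 4 first.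
- exact: measurableC.
- by apply: mh; apply: measurableU => //; exact: measurableC.
- by move=> w _; rewrite lee_fin.
- by apply/disj_setPS => w [].
rewrite EFinD leeD //.
  rewrite (integral_queue arr sys) // lee_fin.
  apply: (@le_trans _ _ (kappa * queue_mean (Amax := Amax) (Q := Q) f m t)).
    rewrite mulr_sumr; apply: ler_sum => q _; rewrite mulrA.
    by rewrite ler_wpM2r ?queue_weight_ge0.
  by rewrite ler_wpM2l // (queue_mean_bound arr sys).
apply: (@le_trans _ _ (\int[P]_(w in ~` E) (cst M%:E w))%E).
  apply: ge0_le_integral => //; first exact: measurableC.
  - by move=> w _; rewrite lee_fin.
  - by apply: mh; exact: measurableC.
  - by move=> w _; rewrite lee_fin.
rewrite integral_cst; last exact: measurableC.
have -> : (P : measure T R) (~` E) = (1 - fine (P E))%:E.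
  by rewrite EFinB fineK ?fin_num_measure //; exact: probability_setC.
by rewrite EFinM.
Qed.

(** First [m] makes the mass of large initial queues negligible against [M], then [t], depending on
    [m], makes the transient term negligible; each costs [e / 2]. *)
Lemma expectation_limit_le (h : 'rV[R]_L -> R) (M kappa : R) : continuous h ->
  (forall x, 0 <= h x) -> (forall x, h x <= M) -> 0 <= kappa ->
  (forall q, h (nat_rv q) <= kappa * f q) ->
  ('E_P'[h \o rvec Y] <= (kappa * (C / (1 - rho)))%:E)%E.
Proof.
move=> hc h0 hM kappa0 hf.
have hb : exists M, forall x, `|h x| <= M by exists M => x; rewrite ger0_norm.
have lim_h := limQ hc hb.
have M0 : 0 <= M by apply: le_trans (hM 0); exact: h0.
apply/lee_addgt0Pr => e e0.
have e2 : 0 < e / 2 by rewrite divr_gt0.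
have [m Mm] : exists m, M * (1 - fine (P (initial_le (Q := Q) m))) <= e / 2.
  have /fine_cvg := initial_le_cvg.
  (* The denominator [M + 1] stays positive when [M = 0]. *)
  move=> /cvgrPdist_lt /(_ (e / 2 / (M + 1))).
  case; first by rewrite divr_gt0 // ltr_wpDl.
  move=> m _ /(_ m (leqnn m)) /= hm; exists m.
  apply: (@le_trans _ _ (M * (e / 2 / (M + 1)))).
    by rewrite ler_wpM2l // (le_trans (ler_norm _)) // ltW.
  by rewrite mulrCA ler_piMr ?ltW // ltr_pdivrMr ?ltr_wpDl //; lra.
have [t0 _ tP] : \forall t \near \oo,
    kappa * (queue_mean (Amax := Amax) (Q := Q) f m 0 * rho ^+ t) <= e / 2.
  have /cvgrPdist_lt /(_ _ e2) : (fun t =>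
    geometric (kappa * queue_mean (Amax := Amax) (Q := Q) f m 0) rho t) @ \oo --> 0.
    by apply: cvg_geometric; rewrite ger0_norm.
  case=> t0 _ tP; exists t0 => // t /tP /=; rewrite sub0r normrN mulrA.
  by move=> /ltW; apply: le_trans; exact: ler_norm.
apply: (cvge_to_le lim_h); exists t0 => // t /tP /= {}tP.
rewrite unlock.
apply: le_trans (@expectation_truncated m t (fun q => h (nat_rv q)) M kappa _ _ _ _) _ => //.
by rewrite -EFinD lee_fin; lra.
Qed.

(** Weak convergence only tests bounded functions, so the power is cut at [n]; the bound does not
    depend on [n], and monotone convergence removes the cut. *)
Lemma expectation_expr_le (c : 'rV[R]_L) (r : nat) (kappa : R) : 0 <= kappa ->
  (forall q, enorm (perp c (nat_rv q)) ^+ r <= kappa * f q) ->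
  ('E_P'[fun w => (enorm (perp c (rvec Y w)) ^+ r)%R] <=
    (kappa * (C / (1 - rho)))%:E)%E.
Proof.
move=> kappa0 hf.
pose g n (x : 'rV[R]_L) := Num.min (enorm (perp c x) ^+ r) n%:R.
have g_cont n : continuous (g n).
  move=> x; apply: (@continuous_min _ _ (fun x => enorm (perp c x) ^+ r) (fun=> n%:R)).
    apply: (@continuous_comp _ _ _ _ (fun y : R => y ^+ r)).
      exact: continuous_enorm_perp.
    exact: exprn_continuous.
  exact: cst_continuous.
have Xr0 x : 0 <= enorm (perp c x) ^+ r by rewrite exprn_ge0 ?enorm_ge0.
have g0 n x : 0 <= g n x by rewrite le_min Xr0 ler0n.
have gY n : ('E_P'[g n \o rvec Y] <= (kappa * (C / (1 - rho)))%:E)%E.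
  apply: (@expectation_limit_le _ n%:R) => //.
    by move=> x; rewrite ge_min lexx orbT.
  by move=> q; rewrite ge_min hf.
have mX : measurable_fun setT (fun w => enorm (perp c (rvec Y w)) ^+ r).
  by apply: measurable_funX; exact: measurable_enorm_perp.
have := @cvg_monotone_convergence _ _ _ P' setT measurableT
  (fun n w => (g n (rvec Y w))%:E) _ _ _.
have lim_g w : limn (fun n => (g n (rvec Y w))%:E) =
    (enorm (perp c (rvec Y w)) ^+ r)%:E.
  apply: lim_near_cst => //.
  (* Pointwise, the cut has no effect once [n] exceeds the value. *)
  exists (Num.trunc (enorm (perp c (rvec Y w)) ^+ r)).+1 => // n /= n_ge.
  congr EFin; apply/min_idPl; apply: ltW; apply: lt_le_trans (truncnS_gt _) _.
  by rewrite ler_nat.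
under eq_integral do rewrite lim_g.
rewrite unlock => cvg_g; apply: cvge_to_le (cvg_g _ _ _) _.
- move=> n; apply/measurable_EFinP; apply: measurable_minr => //.
- by move=> n w _; rewrite lee_fin.
- move=> w _ m n mn; rewrite lee_fin le_min ge_min lexx /=.
  by rewrite ge_min ler_nat mn orbT.
by apply: nearW => n; have := gY n; rewrite unlock.
Qed.

End SteadyState.

(** * Uniform moment bounds from constants fixed before [e] *)

Theorem proposition2 (R : realType) (L Amax Smax : nat)
  (calS : {fset {ffun 'I_L -> nat}})
  (calS_le : forall s, s \in calS -> forall l, (s l <= Smax)%N)
  (calS_0 : [ffun => 0%N] \in calS)
  (K : nat) (c : 'I_K -> 'rV[R]_L) (b : 'I_K -> R)
  (region_cb : minimal_description (capacity_region R calS) c b)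
  (k : 'I_K) (lam : 'rV[R]_L)
  (lam_face : relint (face (capacity_region R calS) (c k) (b k)) lam)
  (d d' : R -> measure_display)
  (T : forall e : R, measurableType (d e))
  (T' : forall e : R, measurableType (d' e))
  (P : forall e : R, probability (T e) R)
  (P' : forall e : R, probability (T' e) R)
  (A S Q : forall e : R, nat -> 'I_L -> {RV (P e) >-> nat})
  (Qbar : forall e : R, 'I_L -> {RV (P' e) >-> R})
  (arrivals : forall e : R, 0 < e ->
     interior (capacity_region R calS) (lam - e *: c k) ->
     arrival_process Amax (lam - e *: c k) (A e))
  (scheduler : forall e : R, 0 < e ->
     interior (capacity_region R calS) (lam - e *: c k) ->
     mw_system calS (A e) (S e) (Q e))
  (limit : forall e : R, 0 < e ->
     interior (capacity_region R calS) (lam - e *: c k) ->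
     steady_state (Q e) (Qbar e)) :
  exists N : nat -> R, forall e : R, 0 < e ->
    interior (capacity_region R calS) (lam - e *: c k) ->
    forall r : nat, (0 < r)%N ->
      ('E_(P' e)[fun w => (enorm (perp (c k) (rvec (Qbar e) w)) ^+ r)%R]
        <= (N r)%:E)%E.
Proof.
(* If no [e] is admissible the claim is vacuous; otherwise a single [e0] supplies the interior point
   that yields [delta] for all [e]. *)
have [[e0 [_ int0]]|none] := pselect (exists e, 0 < e /\
    interior (capacity_region R calS) (lam - e *: c k)); last first.
  by exists (fun=> 0) => e e_gt0 int_e; case: none; exists e.
have [delta delta0 ball] := relint_face_ball region_cb int0 lam_face.
have [[c1 c0 b0 regionE] _] := region_cb.
have [/= lam_k _] := lam_face.1.
have service_le s : s \in calS -> dotr (c k) (nat_rv s) <= b k.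
  by move=> /(@capacity_region_nat_rv R); rewrite regionE => -[_].
pose D := @jump_bound R L Amax Smax.
have [theta [theta0 thetaD thetaD2 thetadelta]] :=
  drift_exponent delta0 (jump_bound_ge1 Amax Smax : 1 <= D).
pose rho := 1 - theta * delta / 4; pose C := expR (theta * (D ^+ 2 / delta + D)).
have rho0 : 0 <= rho by rewrite subr_ge0 ler_pdivrMr // mul1r.
have rho1 : rho < 1 by rewrite ltrBlDr ltrDl divr_gt0 // mulr_gt0.
(* The factor of [expr_le_expR] times the limiting bound on the exponential moment. *)
exists (fun r => (r%:R / theta) ^+ r * (C / (1 - rho))) => e e_gt0 int_e r r_gt0.
have arr := arrivals e e_gt0 int_e.
apply: (expectation_expr_le arr (scheduler e e_gt0 int_e)
  (f := fun q => expR (theta * enorm (perp (c k) (nat_rv q))))) => //.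
- exact: expR_ge0.
- move=> t q s sq; have sS : s \in calS by move: sq; rewrite !inE => /andP[].
  apply: (mw_exp_drift (c1 k) (c0 k) delta0 lam_k ball (e := e)) => //.
  + exact: calS_le.
  + exact: service_le.
  + by move=> a; exact: arrival_weight_ge0.
  + exact: (sum_arrival_weight arr).
  + by move=> a; exact: (arrival_weight_le arr).
  + exact: (sum_arrival_mean arr).
- by have [] := limit e e_gt0 int_e.
- by rewrite exprn_ge0 // divr_ge0 // ltW.
- by move=> q; exact: (expr_le_expR theta0 (enorm_ge0 _)).
Qed.
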